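(* Let $(\mathcal{A},Q)$ be an almost commutative $Q$-algebra of degree $1$ (with respect to an abelian group $G$ and cocycle $\rho$), let $[\![-,-]\!]_Q$ and $\mathrm{a}_Q$ denote the associated derived $\rho$-antibracket and anchor map, and let $\mathcal{B}=\bigoplus_{a\in G}\mathcal{A}_{(0,a)}$. Then the derived $\rho$-antibracket satisfies the following $\rho$-Leibniz rule: for all homogeneous $\sigma,\psi\in\mathrm{Sec}(\mathcal{A})$ and $f\in\mathcal{B}$, $$[\![\sigma,f\psi]\!]_Q=\big(\mathrm{a}_Q(\sigma)f\big)\,\psi+\rho(|\sigma|+|Q|,|f|)\,f\,[\![\sigma,\psi]\!]_Q .$$
   Context: Let $\mathbb{K}=\mathbb{R}$ or $\mathbb{C}$ and let $G$ be an abelian group written additively. A cocycle is a map $\rho:G\times G\to\mathbb{K}$ with $\rho(a,b)=\rho(b,a)^{-1}$ and $\rho(a+b,c)=\rho(a,c)\rho(b,c)$ for all $a,b,c\in G$. For a $G$-graded associative $\mathbb{K}$-algebra, $|f|\in G$ denotes the degree of a homogeneous element $f$ and the $\rho$-commutator is $[f,g]_\rho := fg-\rho(|f|,|g|)\,gf$ (extended linearly; all formulas are for homogeneous elements and extended by linearity). The algebra is $\rho$-commutative (almost commutative) if $[f,g]_\rho=0$ for all $f,g$. The same formula defines the $\rho$-commutator of homogeneous linear maps. An almost commutative non-negatively graded algebra is an $(\mathbb{N},G)$-bigraded algebra $\mathcal{A}=\bigoplus_{i\in\mathbb{N},a\in G}\mathcal{A}_{(i,a)}$ (with $\mathcal{A}_{(i,a)}\cdot\mathcal{A}_{(j,b)}\subset\mathcal{A}_{(i+j,a+b)}$,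 $0\in\mathbb{N}$) that is $\rho$-commutative with respect to the $G$-degree; the $\mathbb{N}$-degree is called weight and plays no role in the commutation rule. Put $\mathcal{A}_i:=\bigoplus_{a}\mathcal{A}_{(i,a)}$, let $\mathrm{Alg}(\mathcal{A}_i)$ be the subalgebra generated by $\mathcal{A}_0\oplus\cdots\oplus\mathcal{A}_i$, and $\mathcal{A}_{\langle i\rangle}:=\mathrm{Alg}(\mathcal{A}_{i-1})\cap\mathcal{A}_i$. $\mathcal{A}$ is of degree $n$ if $\mathcal{A}_i/\mathcal{A}_{\langle i\rangle}=\{0\}$ for all $i>n$ (by convention $n$ is the least such integer). A $\rho$-derivation of a $G$-graded algebra $\mathcal{A}$ of $G$-degree $|X|$ is a linear map $X:\mathcal{A}\to\mathcal{A}$ of $G$-degree $|X|$ with $X(fg)=(Xf)g+\rho(|X|,|f|)\,f(Xg)$. $\rho\mathrm{Der}(\mathcal{A})$ is the $G$-graded vector space of all $\rho$-derivations; it is closed under $[-,-]_\rho$, and for $\mathcal{A}$ almost commutative it is a left $\mathcal{A}$-module via $(fX)g=f(Xg)$. For bigraded $\mathcal{A}$ it is also $\mathbb{Z}$-graded by weight: $\rho\mathrm{Der}_i(\mathcal{A})$ consists of the $\rho$-derivations that shift weight by $i$. A homological $\rho$-derivation is a homogeneous $Q\in\rho\mathrm{Der}(\mathcal{A})$ with $\rho(|Q|,|Q|)=-1$ and $[Q,Q]_\rho=0$. An almost commutative $Q$-algebra of degree $1$ is a pair $(\mathcal{A},Q)$ with $\mathcal{A}$ an almost commutative non-negatively graded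 algebra of degree one and $Q$ a homological $\rho$-derivation of $\mathcal{A}$ of weight ($\mathbb{Z}$-degree) $1$. Its sections are $\mathrm{Sec}(\mathcal{A}):=\rho\mathrm{Der}_-(\mathcal{A})$, the $\rho$-derivations of negative weight (which here all have weight $-1$), graded by $G$-degree; this is a left module over the $\rho$-commutative algebra $\mathcal{B}$. The derived $\rho$-antibracket is the bilinear map $\mathrm{Sec}(\mathcal{A})\times\mathrm{Sec}(\mathcal{A})\to\mathrm{Sec}(\mathcal{A})$, $[\![\sigma,\psi]\!]_Q:=\rho(|\sigma|+|Q|,|Q|)\,[[Q,\sigma]_\rho,\psi]_\rho$. The anchor map is the morphism of left $\mathcal{B}$-modules $\mathrm{a}_Q:\mathrm{Sec}(\mathcal{A})\to\rho\mathrm{Der}(\mathcal{B})$ defined by $\mathrm{a}_Q(\sigma)f:=\rho(|\sigma|+|Q|,|Q|)\,[Q,\sigma]_\rho(f)=\sigma(Q(f))$ for $f\in\mathcal{B}$. *)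

(* Defs.v *)
From HB Require Import structures.
From mathcomp Require Import all_boot all_order all_algebra.
From mathcomp Require Import sesquilinear.
From mathcomp Require Import boolp classical_sets reals.
From mathcomp Require Import complex.

Set Implicit Arguments.
Unset Strict Implicit.
Unset Printing Implicit Defensive.

Import Order.TTheory GRing.Theory Num.Theory.
Local Open Scope classical_set_scope.
Local Open Scope ring_scope.

Inductive scalar_kind := RealScalars | ComplexScalars.

Definition scalars (R : realType) (k : scalar_kind) : fieldType :=
  match k with RealScalars => R | ComplexScalars => R[i]%C end.

(* In MathComp 0^-1 = 0, so non-vanishing has to be required separately:
   otherwise rho = 0 would qualify. *)
Record cocycle (K : fieldType) (G : zmodType) := Cocycle {
  cocycle_fun :> G -> G -> K;
  cocycle_neq0 : forall a b, cocycle_fun a b != 0;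
  cocycle_inv : forall a b, cocycle_fun a b = (cocycle_fun b a)^-1;
  cocycle_addl : forall a b c,
    cocycle_fun (a + b) c = cocycle_fun a c * cocycle_fun b c
}.

Definition is_subspace (K : fieldType) (V : lmodType K) (S : set V) : Prop :=
  submod_closed (mem S).

Section Sums.
Variables (K : fieldType) (I : eqType) (V : lmodType K) (F : I -> set V).

(* The sum of the subspaces F p for p in P, i.e. all finite sums of elements
   of these subspaces. *)
Definition sum_of (P : set I) : set V :=
  [set x | exists2 s : seq V,
     (forall y, y \in s -> exists2 p, P p & F p y) & x = \sum_(y <- s) y].

Definition independent : Prop :=
  forall (s : seq I) (c : I -> V), uniq s -> (forall p, F p (c p)) ->
    \sum_(p <- s) c p = 0 -> forall p, p \in s -> c p = 0.

Definition direct_sum_decomposition : Prop :=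
  [/\ forall p, is_subspace (F p), sum_of setT = setT & independent].

Lemma sum_of_ind (P : set I) (D : set V) :
    D 0 -> (forall x y, D x -> D y -> D (x + y)) ->
    (forall p x, P p -> F p x -> D x) ->
  forall x, sum_of P x -> D x.
Proof.
move=> D0 DD DF _ [s + ->]; elim: s => [|y s IH] Fs; first by rewrite big_nil.
rewrite big_cons; apply: DD.
  by have [p Pp Fpy] := Fs y (mem_head _ _); exact: DF Fpy.
by apply: IH => z zs; apply: Fs; rewrite inE zs orbT.
Qed.

Lemma sum_of_incl (P : set I) p x : P p -> F p x -> sum_of P x.
Proof.
move=> Pp Fpx; exists [:: x]; last by rewrite big_seq1.
by move=> y; rewrite inE => /eqP ->; exists p.
Qed.

Lemma sum_of0 (P : set I) : sum_of P 0.
Proof. by exists [::] => //; rewrite big_nil. Qed.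

Lemma sum_ofD (P : set I) x y : sum_of P x -> sum_of P y -> sum_of P (x + y).
Proof.
move=> [s Fs ->] [t Ft ->]; exists (s ++ t); last by rewrite big_cat.
by move=> z; rewrite mem_cat => /orP[/Fs|/Ft].
Qed.

Lemma sum_ofZ (P : set I) (k : K) x : (forall p, is_subspace (F p)) ->
  sum_of P x -> sum_of P (k *: x).
Proof.
move=> Fsub; apply: (sum_of_ind (D := fun x => sum_of P (k *: x))).
- by rewrite scaler0; exact: sum_of0.
- by move=> u v Du Dv; rewrite scalerDr; exact: sum_ofD.
move=> p u Pp Fu; apply: (sum_of_incl Pp).
have [F0 FZ] := Fsub p.
have := FZ k u 0 (mem_set Fu) F0.
by rewrite addr0 => /set_mem.
Qed.

End Sums.

(* An associative K-algebra (no unit is required) with a bigrading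
   A = (+)_(i, a) A_(i, a), i in nat (weight), a in G. *)
Record bigraded_algebra (K : fieldType) (G : zmodType) := BigradedAlgebra {
  ba_sort :> lmodType K;
  ba_mul : {bilinear ba_sort -> ba_sort -> ba_sort};
  ba_mulA : associative ba_mul;
  ba_comp : nat * G -> set ba_sort;
  ba_decomp : direct_sum_decomposition ba_comp;
  ba_comp_mul : forall i j a b x y, ba_comp (i, a) x -> ba_comp (j, b) y ->
    ba_comp ((i + j)%N, a + b) (ba_mul x y)
}.

Section AlmostCommutative.
Variables (K : fieldType) (G : zmodType) (rho : cocycle K G).
Variable A : bigraded_algebra K G.

Implicit Types (f g x y : A) (a b : G) (X Y : {linear A -> A}).

Local Notation "x ** y" := (ba_mul A x y) (at level 40, left associativity).

Definition degree_part (a : G) : set A :=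
  sum_of (@ba_comp _ _ A) [set p | p.2 = a].

Definition weight_part (i : nat) : set A :=
  sum_of (@ba_comp _ _ A) [set p | p.1 = i].

(* The weight grading extended to the integers by 0. *)
Definition weight_partz (z : int) : set A :=
  match z with Posz i => weight_part i | Negz _ => [set 0] end.

Definition rho_commutative : Prop :=
  forall a b f g, degree_part a f -> degree_part b g ->
    f ** g - rho a b *: (g ** f) = 0.

Definition is_subalgebra (S : set A) : Prop :=
  is_subspace S /\ forall x y, S x -> S y -> S (x ** y).

Definition Alg (i : nat) : set A :=
  smallest is_subalgebra (sum_of (@ba_comp _ _ A) [set p | (p.1 <= i)%N]).

Definition decomposable_part (i : nat) : set A := Alg i.-1 `&` weight_part i.

Definition generated_up_to (n : nat) : Prop :=
  forall i, (n < i)%N -> weight_part i `<=` decomposable_part i.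

Definition algebra_degree (n : nat) : Prop :=
  generated_up_to n /\ forall m, generated_up_to m -> (n <= m)%N.

Definition homogeneous_map (d : G) X : Prop :=
  forall a x, degree_part a x -> degree_part (a + d) (X x).

Record hlinear := HLinear {
  hmap :> {linear A -> A};
  hdeg : G;
  hmapP : homogeneous_map hdeg hmap
}.

Fact rho_bracket_subproof (X Y : hlinear) :
  homogeneous_map (hdeg X + hdeg Y)
    ((X \o Y) \- (rho (hdeg X) (hdeg Y) \*: (Y \o X))).
Proof.
move=> a x ax /=; have [Asub _ _] := ba_decomp A.
rewrite -scaleNr; apply: sum_ofD.
  by rewrite [hdeg X + _]addrC addrA; do 2!apply: hmapP.
by apply: sum_ofZ => //; rewrite addrA; do 2!apply: hmapP.
Qed.

Definition rho_bracket (X Y : hlinear) : hlinear :=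
  HLinear (rho_bracket_subproof X Y).

Fact hscale_subproof (k : K) (X : hlinear) :
  homogeneous_map (hdeg X) (k \*: X).
Proof.
move=> a x ax /=; have [Asub _ _] := ba_decomp A.
by apply: sum_ofZ => //; exact: hmapP.
Qed.

Definition hscale (k : K) (X : hlinear) : hlinear :=
  HLinear (hscale_subproof k X).

Definition rho_derivation (X : hlinear) : Prop :=
  forall a f g, degree_part a f ->
    X (f ** g) = X f ** g + rho (hdeg X) a *: (f ** X g).

Definition has_weight (w : int) (X : {linear A -> A}) : Prop :=
  forall (i : nat) x, weight_part i x -> weight_partz (i%:Z + w) (X x).

Definition homological (Q : hlinear) : Prop :=
  [/\ rho_derivation Q, rho (hdeg Q) (hdeg Q) = -1
    & rho_bracket Q Q =1 (fun=> 0)].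

Definition Q_algebra_of_degree_1 (Q : hlinear) : Prop :=
  [/\ rho_commutative, algebra_degree 1, homological Q & has_weight 1 Q].

(* G-homogeneous elements of Sec(A), the derivations of negative weight.
   When A has degree 1 there are none of weight < -1 besides 0, so that no
   sums of derivations of different weights have to be considered. *)
Definition is_section (s : hlinear) : Prop :=
  rho_derivation s /\ exists2 w : int, w < 0 & has_weight w s.

(* G-homogeneous elements of B = (+)_a A_(0, a) *)
Record base_element := BaseElement {
  bval : A;
  bdeg : G;
  bvalP : ba_comp (0%N, bdeg) bval
}.

(* The left module structure (f X) g = f (X g) on linear maps. *)
Definition lact f X : {linear A -> A} := ba_mul A f \o X.

Fact hact_subproof (f : base_element) (X : hlinear) :
  homogeneous_map (bdeg f + hdeg X) (lact (bval f) X).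
Proof.
move=> a x ax; rewrite addrCA /=.
move: (X x) (hmapP X ax); apply: sum_of_ind.
- by rewrite linear0r; exact: sum_of0.
- by move=> u v Du Dv; rewrite linearDr; exact: sum_ofD.
move=> [i b] u /= <- Fu.
exact: (sum_of_incl (p := ((0 + i)%N, bdeg f + b)))
  (ba_comp_mul (bvalP f) Fu).
Qed.

Definition hact (f : base_element) (X : hlinear) : hlinear :=
  HLinear (hact_subproof f X).

Definition derived_antibracket (Q s p : hlinear) : hlinear :=
  hscale (rho (hdeg s + hdeg Q) (hdeg Q)) (rho_bracket (rho_bracket Q s) p).

Definition anchor (Q s : hlinear) (f : base_element) : A :=
  rho (hdeg s + hdeg Q) (hdeg Q) *: rho_bracket Q s (bval f).

End AlmostCommutative.

(* Main.v *)
Require Import Defs.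
From mathcomp Require Import all_boot all_order all_algebra.
From mathcomp Require Import sesquilinear.
From mathcomp Require Import reals.
Import GRing.Theory.
Local Open Scope ring_scope.

(** The antibracket [[sigma, -]] is, up to the scalar
    c := rho (|sigma| + |Q|) |Q|, the rho-commutator with D := [Q, sigma]_rho.
    As a rho-commutator of rho-derivations, D is itself a rho-derivation of
    degree |Q| + |sigma| (lemma [rho_bracket_derivation]).  The rho-Leibniz
    rule of D then passes to its commutator with f psi
    (lemma [rho_bracket_hact]): applying D to f (psi x) gives (D f) (psi x)
    and rho (|D|, |f|) f (D (psi x)), and the second term pairs with
    rho (|D|, |f| + |psi|) f (psi (D x)) to form f [D, psi]_rho x, because
    rho is multiplicative in its second argument.  Multiplying by c turns D f
    into the anchor of sigma applied to f. *)

Section RhoDerivations.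
Set Implicit Arguments.
Unset Strict Implicit.
Variables (K : fieldType) (G : zmodType) (rho : cocycle K G).

Lemma cocycle_addr a b c : rho a (b + c) = rho a b * rho a c.
Proof.
by rewrite cocycle_inv cocycle_addl invfM -!(cocycle_inv rho a).
Qed.

Lemma cocycle_mulV a b : rho a b * rho b a = 1.
Proof. by rewrite cocycle_inv mulVf ?cocycle_neq0. Qed.

Variable A : bigraded_algebra K G.
Implicit Types (f g x : A) (X Y : hlinear A).

(** In the second-order Leibniz expansions of X Y and rho(|X|, |Y|) Y X on f g,
    the mixed terms (X f) (Y g) and (Y f) (X g) come with the same
    coefficients, so they cancel in the difference: for (Y f) (X g) both
    coefficients are rho(|X|, |f|) rho(|X|, |Y|), and for (X f) (Y g) the
    factor rho(|X|, |Y|) rho(|Y|, |X|) = 1 drops out. *)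
Lemma rho_bracket_derivation X Y :
  rho_derivation rho X -> rho_derivation rho Y ->
  rho_derivation rho (rho_bracket rho X Y).
Proof.
move=> dX dY a f g fa /=.
rewrite (dX _ _ _ fa) (dY _ _ _ fa) !linearD !linearZ /=.
rewrite (dX _ _ _ fa) (dY _ _ _ fa).
rewrite (dX _ _ _ (hmapP Y fa)) (dY _ _ _ (hmapP X fa)).
rewrite !cocycle_addr cocycle_addl.
rewrite linearDl linearNr linearZl_LR linearNl /=.
rewrite !(opprD, scalerDr, scalerN, scalerA).
have -> : rho (hdeg X) (hdeg Y) * (rho (hdeg Y) a * rho (hdeg Y) (hdeg X)) =
          rho (hdeg Y) a.
  by rewrite mulrCA cocycle_mulV mulr1.
rewrite mulrA [rho (hdeg Y) a * _]mulrC [rho (hdeg X) (hdeg Y) * _]mulrC.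
(* Brings each mixed term next to its opposite. *)
rewrite (AC ((2*2)*(2*2)) ((1*5)*(4*8)*((2*7)*(3*6)))) /=.
by rewrite !subrr !addr0.
Qed.

(** Only in the composite X o (f Y) is X applied to a product, f (Y x); its
    Leibniz rule there contributes the term (X f) (Y x), and everything else
    has f as a left factor. *)
Lemma rho_bracket_hact X Y (f : base_element A) x :
  rho_derivation rho X ->
  rho_bracket rho X (hact f Y) x =
    ba_mul A (X (bval f)) (Y x)
    + rho (hdeg X) (bdeg f) *: ba_mul A (bval f) (rho_bracket rho X Y x).
Proof.
move=> dX /=.
have fP : degree_part (bdeg f) (bval f).
  exact: (sum_of_incl (p := (0%N, bdeg f))) (bvalP f).
rewrite (dX _ _ _ fP) cocycle_addr linearBr linearZr_LR scalerBr scalerA.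
by rewrite addrA.
Qed.

End RhoDerivations.

Theorem proposition4p6 (R : realType) (k : scalar_kind) (G : zmodType)
    (rho : cocycle (scalars R k) G) (A : bigraded_algebra (scalars R k) G)
    (Q : hlinear A) (hQ : Q_algebra_of_degree_1 rho Q)
    (sigma psi : hlinear A) (hsigma : is_section rho sigma)
    (hpsi : is_section rho psi) (f : base_element A) :
  derived_antibracket rho Q sigma (hact f psi) =1
    lact (anchor rho Q sigma f) psi \+
    rho (hdeg sigma + hdeg Q) (bdeg f) \*:
      lact (bval f) (derived_antibracket rho Q sigma psi).
Proof.
move=> x; have [_ _ [dQ _ _] _] := hQ; have [dsigma _] := hsigma.
have dD := rho_bracket_derivation dQ dsigma.
transitivity (rho (hdeg sigma + hdeg Q) (hdeg Q) *:
  rho_bracket rho (rho_bracket rho Q sigma) (hact f psi) x); first by [].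
rewrite (rho_bracket_hact psi f x dD) scalerDr.
congr (_ + _); first by rewrite /lact /anchor /= linearZl_LR.
rewrite [hdeg (rho_bracket rho Q sigma)]addrC scalerA mulrC -scalerA.
by rewrite [in RHS]/= [in RHS]linearZr_LR.
Qed.
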